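(* Let $R>0$, $Q,K,V\in\mathbb R^{k\times d}$ and $A:=K^\top Q/\sqrt k$. The mean-field self-attention map $F$ with parameters $(A,V)$ is $W_2$-Lipschitz continuous on $\mathcal P(B_R)$, and $$\mathrm{Lip}^{W_2}\big(F_{|\mathcal P(B_R)}\big)\le\|V\|_2\,(1+3\|A\|_2R^2)\,e^{2\|A\|_2R^2}.$$
   Context: $\mathcal P(B_R)$ is the set of Borel probability measures supported in the closed ball $B_R\subset\mathbb R^d$ of center $0$ and radius $R$. Mean-field self-attention with parameters $(A,V)$ maps a compactly supported probability measure $\mu$ on $\mathbb R^d$ to $F(\mu):=(\Gamma_\mu)_\sharp\mu$, where $\Gamma_\mu(x)=\dfrac{\int\exp(x^\top A^\top y)\,Vy\,d\mu(y)}{\int\exp(x^\top A^\top y)\,d\mu(y)}$ and $\varphi_\sharp\mu$ denotes the pushforward ($\varphi_\sharp\mu(B)=\mu(\varphi^{-1}(B))$). $W_2(\mu,\nu)=\big(\inf_{\pi\in\Pi(\mu,\nu)}\int|x-y|^2d\pi(x,y)\big)^{1/2}$ is the 2-Wasserstein distance, $\Pi(\mu,\nu)$ being the set of couplings. $\mathrm{Lip}^{W_2}(F_{|\mathcal X})=\sup_{\mu\ne\nu\in\mathcal X}W_2(F(\mu),F(\nu))/W_2(\mu,\nu)$. $\|\cdot\|_2$ is the spectral norm. *)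

(* Defs.v *)
From HB Require Import structures.
From mathcomp Require Import all_boot all_order all_algebra.
From mathcomp Require Import all_classical all_reals all_analysis.
Unset Printing Implicit Defensive.
Import Order.TTheory GRing.Theory Num.Theory.
Import numFieldNormedType.Exports.
Local Open Scope classical_set_scope.
Local Open Scope ring_scope.

Section Defs.
Variable R : realType.

Definition Rvec (n : nat) := g_sigma_algebraType (@open 'cV[R]_n).

Definition eucl_norm {n : nat} (x : 'cV[R]_n) : R :=
  Num.sqrt (\sum_(i < n) x i ord0 ^+ 2).

Definition spec_norm {m n : nat} (M : 'M[R]_(m, n)) : R :=
  sup [set eucl_norm (M *m x) | x in [set x : 'cV[R]_n | eucl_norm x <= 1]].

Definition cball (n : nat) (r : R) : set (Rvec n) :=
  [set x : 'cV[R]_n | eucl_norm x <= r].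

Definition Pball (n : nat) (r : R) : set (probability (Rvec n) R) :=
  [set mu | mu (~` cball n r) = 0%E].

Definition is_coupling {n : nat} (mu nu : set (Rvec n) -> \bar R)
    (pi : probability (Rvec n * Rvec n)%type R) : Prop :=
  (forall A : set (Rvec n), measurable A -> pi (fst @^-1` A) = mu A) /\
  (forall B : set (Rvec n), measurable B -> pi (snd @^-1` B) = nu B).

Definition sqrte (x : \bar R) : \bar R :=
  match x with
  | r%:E => (Num.sqrt r)%:E
  | +oo%E => +oo%E
  | -oo%E => 0%E
  end.

Definition W2 {n : nat} (mu nu : set (Rvec n) -> \bar R) : \bar R :=
  sqrte (ereal_inf [set (\int[pi]_z ((eucl_norm ((z.1 : 'cV[R]_n) - z.2)) ^+ 2)%:E)%E
                   | pi in [set pi | is_coupling mu nu pi]]).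

Definition bil {d : nat} (A : 'M[R]_d) (x y : 'cV[R]_d) : R :=
  ((x^T *m A^T *m y) ord0 ord0).

Definition Gamma {d k : nat} (A : 'M[R]_d) (V : 'M[R]_(k, d))
    (mu : probability (Rvec d) R) (x : Rvec d) : Rvec k :=
  \col_(i < k) (Rintegral mu setT (fun y : Rvec d => expR (bil A x y) * (V *m y) i ord0)
               / Rintegral mu setT (fun y : Rvec d => expR (bil A x y))).

Definition SA {d k : nat} (A : 'M[R]_d) (V : 'M[R]_(k, d))
    (mu : probability (Rvec d) R) : set (Rvec k) -> \bar R :=
  fun B => mu (Gamma A V mu @^-1` B).

Definition LipW2 {d k : nat} (X : set (probability (Rvec d) R))
    (F : probability (Rvec d) R -> set (Rvec k) -> \bar R) : \bar R :=
  ereal_sup [set l | exists mu nu : probability (Rvec d) R,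
      [/\ X mu, X nu, (mu : set (Rvec d) -> \bar R) <> nu &
       l = ((fine (W2 (F mu) (F nu))) / fine (W2 mu nu))%:E]].
End Defs.
Arguments eucl_norm {R n}.
Arguments spec_norm {R m n}.
Arguments is_coupling {R n}.
Arguments sqrte {R}.
Arguments W2 {R n}.
Arguments bil {R d}.
Arguments Gamma {R d k}.
Arguments SA {R d k}.
Arguments LipW2 {R d k}.

(* Main.v *)
Require Import Defs.
From HB Require Import structures.
From mathcomp Require Import all_boot all_order all_algebra.
From mathcomp Require Import all_classical all_reals all_analysis.
From mathcomp Require Import measurable_realfun ring lra.
Import Order.TTheory GRing.Theory Num.Theory.
Import numFieldNormedType.Exports.
Local Open Scope classical_set_scope.
Local Open Scope ring_scope.

(* Fix a coupling pi of mu and nu and put t = |A| R^2. For x, y in the ball,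
   split Gamma_mu(x) - Gamma_nu(y) into Gamma_mu(x) - Gamma_mu(y), which is at
   most |V| t e^{2t} |x - y|, and Gamma_mu(y) - Gamma_nu(y), which is at most
   |V| (1 + 2t) e^{2t} times the mean of |u - v| under pi. Both bounds are
   obtained by testing against a vector e, which turns Gamma into a scalar
   weighted mean N / Z; subtracting from the integrand the other mean c makes
   its contribution to the difference vanish. The L^2(pi) norm of
   Gamma_mu(x) - Gamma_nu(y) is then at most |V| (1 + 3t) e^{2t} times that of
   x - y, and pushing pi forward by (Gamma_mu, Gamma_nu) gives a coupling of
   the images. *)

(** * Euclidean geometry: inner product, spectral norm, bilinear scores *)

Section Euclidean.
Context {R : realType}.

Definition dot {n : nat} (x y : 'cV[R]_n) : R := \sum_(i < n) x i ord0 * y i ord0.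

Lemma dotDl n (x y z : 'cV[R]_n) : dot (x + y) z = dot x z + dot y z.
Proof. by rewrite -big_split; apply: eq_bigr => i _; rewrite mxE mulrDl. Qed.

Lemma dotC n (x y : 'cV[R]_n) : dot x y = dot y x.
Proof. by apply: eq_bigr => i _; rewrite mulrC. Qed.

Lemma dotDr n (x y z : 'cV[R]_n) : dot x (y + z) = dot x y + dot x z.
Proof. by rewrite !(dotC _ x) dotDl. Qed.

Lemma dotZl n (a : R) (x y : 'cV[R]_n) : dot (a *: x) y = a * dot x y.
Proof. by rewrite mulr_sumr; apply: eq_bigr => i _; rewrite mxE mulrA. Qed.

Lemma dotNl n (x y : 'cV[R]_n) : dot (- x) y = - dot x y.
Proof. by rewrite -scaleN1r dotZl mulN1r. Qed.

Lemma dotNr n (x y : 'cV[R]_n) : dot x (- y) = - dot x y.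
Proof. by rewrite dotC dotNl dotC. Qed.

Lemma dot_ge0 n (x : 'cV[R]_n) : 0 <= dot x x.
Proof. by apply: sumr_ge0 => i _; rewrite -expr2 sqr_ge0. Qed.

Lemma eucl_normE n (x : 'cV[R]_n) : eucl_norm x = Num.sqrt (dot x x).
Proof. by congr Num.sqrt; apply: eq_bigr => i _; rewrite expr2. Qed.

Lemma eucl_norm_ge0 n (x : 'cV[R]_n) : 0 <= eucl_norm x.
Proof. exact: sqrtr_ge0. Qed.

Lemma sqr_eucl_norm n (x : 'cV[R]_n) : eucl_norm x ^+ 2 = dot x x.
Proof. by rewrite eucl_normE sqr_sqrtr ?dot_ge0. Qed.

Lemma eucl_normZ n (a : R) (x : 'cV[R]_n) : eucl_norm (a *: x) = `|a| * eucl_norm x.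
Proof.
by rewrite !eucl_normE dotZl dotC dotZl mulrA -expr2 sqrtrM ?sqr_ge0// sqrtr_sqr.
Qed.

Lemma eucl_normN n (x : 'cV[R]_n) : eucl_norm (- x) = eucl_norm x.
Proof. by rewrite -scaleN1r eucl_normZ normrN1 mul1r. Qed.

Lemma eucl_norm0 n : eucl_norm (0 : 'cV[R]_n) = 0.
Proof. by rewrite -(scale0r (0 : 'cV[R]_n)) eucl_normZ normr0 mul0r. Qed.

Lemma coord_le_eucl_norm n (x : 'cV[R]_n) i : `|x i ord0| <= eucl_norm x.
Proof.
rewrite -sqrtr_sqr ler_wsqrtr// (bigD1 i)//= lerDl.
by apply: sumr_ge0 => j _; exact: sqr_ge0.
Qed.

Lemma eucl_norm_eq0 n (x : 'cV[R]_n) : eucl_norm x = 0 -> x = 0.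
Proof.
move=> x0; apply/colP => i; rewrite mxE; apply/eqP.
by rewrite -normr_le0 -x0 coord_le_eucl_norm.
Qed.

Lemma cauchy_schwarz n (x y : 'cV[R]_n) : `|dot x y| <= eucl_norm x * eucl_norm y.
Proof.
have [y0|y0] := eqVneq (dot y y) 0.
  have -> : y = 0 by apply: eucl_norm_eq0; rewrite eucl_normE y0 sqrtr0.
  by rewrite -(scale0r (0 : 'cV[R]_n)) dotC dotZl mul0r normr0 mulr_ge0 ?eucl_norm_ge0.
have yp : 0 < dot y y by rewrite lt0r y0 dot_ge0.
rewrite -ler_sqr ?nnegrE ?mulr_ge0 ?eucl_norm_ge0//.
rewrite exprMn !sqr_eucl_norm real_normK ?num_real// -subr_ge0.
rewrite -(pmulr_rge0 _ yp).
(* This vector is [dot y y] times the component of [x] orthogonal to [y]; its squared norm is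
   [dot y y] times the difference to be shown nonnegative, so no division occurs. *)
have := dot_ge0 _ (dot y y *: x - dot x y *: y).
rewrite !(dotDl, dotDr, dotNl, dotNr, dotZl).
rewrite !(dotC _ x (_ *: _)) !(dotC _ y (_ *: _)) !dotZl (dotC _ y x).
by congr (0 <= _); ring.
Qed.

Lemma eucl_normD n (x y : 'cV[R]_n) : eucl_norm (x + y) <= eucl_norm x + eucl_norm y.
Proof.
rewrite -ler_sqr ?nnegrE ?addr_ge0 ?eucl_norm_ge0//.
rewrite sqr_eucl_norm !(dotDl, dotDr) (dotC _ y x) sqrrD !sqr_eucl_norm.
have := ler_norm (dot x y); have := cauchy_schwarz _ x y; lra.
Qed.

Lemma eucl_normB n (x y : 'cV[R]_n) : eucl_norm (x - y) <= eucl_norm x + eucl_norm y.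
Proof. by rewrite -(eucl_normN _ y) eucl_normD. Qed.

Lemma eucl_norm_le_sum n (x : 'cV[R]_n) : eucl_norm x <= \sum_i `|x i ord0|.
Proof.
rewrite -ler_sqr ?nnegrE ?eucl_norm_ge0 ?sumr_ge0//.
rewrite sqr_eucl_norm expr2 mulr_suml; apply: ler_sum => i _.
rewrite -expr2 -[leLHS]real_normK ?num_real// expr2 ler_wpM2l//.
by rewrite (bigD1 i)//= lerDl sumr_ge0.
Qed.

(** [sup] takes a default value on sets without a supremum, so this is what gives [spec_norm] its
    meaning. The sum of the absolute values of all entries is a crude upper bound. *)
Lemma spec_norm_has_sup m n (M : 'M[R]_(m, n)) :
  has_sup [set eucl_norm (M *m x) | x in [set x : 'cV[R]_n | eucl_norm x <= 1]].
Proof.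
split; first by exists (eucl_norm (M *m 0)), 0 => //=; rewrite eucl_norm0 ler01.
exists (\sum_i \sum_j `|M i j|) => _ [x /= x1 <-].
apply: le_trans (eucl_norm_le_sum _ _) _; apply: ler_sum => i _.
rewrite mxE; apply: le_trans (ler_norm_sum _ _ _) _; apply: ler_sum => j _.
by rewrite normrM ler_piMr// (le_trans (coord_le_eucl_norm _ _ _)).
Qed.

Lemma spec_norm_ge0 m n (M : 'M[R]_(m, n)) : 0 <= spec_norm M.
Proof.
apply: (ub_le_sup (spec_norm_has_sup _ _ M).2).
by exists 0 => /=; rewrite ?mulmx0 eucl_norm0 ?ler01.
Qed.

Lemma eucl_norm_mulmx m n (M : 'M[R]_(m, n)) (x : 'cV[R]_n) :
  eucl_norm (M *m x) <= spec_norm M * eucl_norm x.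
Proof.
have [x0|x0] := eqVneq (eucl_norm x) 0.
  by rewrite (eucl_norm_eq0 _ _ x0) mulmx0 !eucl_norm0 mulr0.
have xp : 0 < eucl_norm x by rewrite lt0r x0 eucl_norm_ge0.
rewrite -ler_pdivrMr//; apply: (ub_le_sup (spec_norm_has_sup _ _ M).2).
exists ((eucl_norm x)^-1 *: x) => /=.
  by rewrite eucl_normZ ger0_norm ?invr_ge0 ?eucl_norm_ge0// mulVf.
by rewrite -scalemxAr eucl_normZ ger0_norm ?invr_ge0 ?eucl_norm_ge0// mulrC.
Qed.

Lemma bilE d (A : 'M[R]_d) x y : bil A x y = dot (A *m x) y.
Proof. by rewrite /bil -trmx_mul mxE; apply: eq_bigr => i _; rewrite mxE. Qed.

Lemma le_norm_bil d (A : 'M[R]_d) x y :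
  `|bil A x y| <= spec_norm A * eucl_norm x * eucl_norm y.
Proof.
rewrite bilE (le_trans (cauchy_schwarz _ _ _))// ler_wpM2r ?eucl_norm_ge0//.
exact: eucl_norm_mulmx.
Qed.

Lemma bilDl d (A : 'M[R]_d) x y z : bil A (x + y) z = bil A x z + bil A y z.
Proof. by rewrite !bilE mulmxDr dotDl. Qed.

Lemma bilBr d (A : 'M[R]_d) x y z : bil A x (y - z) = bil A x y - bil A x z.
Proof. by rewrite !bilE dotDr dotNr. Qed.

Lemma dotE n (x y : 'cV[R]_n) : dot x y = (x^T *m y) ord0 ord0.
Proof. by rewrite mxE; apply: eq_bigr => i _; rewrite mxE. Qed.

Lemma dot_mulmx m n (M : 'M[R]_(m, n)) (e : 'cV[R]_m) (x : 'cV[R]_n) :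
  dot e (M *m x) = dot (M^T *m e) x.
Proof. by rewrite !dotE trmx_mul trmxK mulmxA. Qed.

Lemma le_norm_dot_mulmx m n (M : 'M[R]_(m, n)) (e : 'cV[R]_m) (x : 'cV[R]_n) :
  `|dot e (M *m x)| <= spec_norm M * eucl_norm e * eucl_norm x.
Proof.
rewrite (le_trans (cauchy_schwarz _ _ _))// (mulrC (spec_norm M)) -mulrA.
by rewrite ler_wpM2l ?eucl_norm_ge0// eucl_norm_mulmx.
Qed.

(** Taking [e = x] gives the bound. Through this duality, estimates on the vector [Gamma] become
    estimates on scalar weighted means with the sharp constant. *)
Lemma eucl_norm_le_dot n (x : 'cV[R]_n) (c : R) : 0 <= c ->
  (forall e, `|dot e x| <= c * eucl_norm e) -> eucl_norm x <= c.
Proof.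
move=> c0 H; have [->//|x0] := eqVneq (eucl_norm x) 0.
have xp : 0 < eucl_norm x by rewrite lt0r x0 eucl_norm_ge0.
rewrite -(ler_pM2r xp) -expr2 sqr_eucl_norm.
exact: le_trans (ler_norm _) (H x).
Qed.

End Euclidean.

(** * Measurable functions bounded on a carrying set, and their closure properties *)

Section BoundedOn.
Context {disp : measure_display} {T : measurableType disp} {R : realType}.

(* [y |-> exp (x^T A^T y)] is unbounded on the whole space, so boundedness is
   required only on a set [D] that carries the measures. *)
Definition mbounded (D : set T) (f : T -> R) : Prop :=
  measurable_fun setT f /\ exists M, forall x, D x -> `|f x| <= M.

Context {D : set T}.

Lemma mbounded_cst (c : R) : mbounded D (fun=> c).
Proof. by split; [exact: measurable_cst|exists `|c|]. Qed.

Lemma mboundedD f g : mbounded D f -> mbounded D g -> mbounded D (fun x => f x + g x).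
Proof.
move=> [mf [M fM]] [mg [N gN]]; split; first exact: measurable_funD.
exists (M + N) => x Dx; apply: le_trans (ler_normD _ _) _.
by rewrite lerD ?fM ?gN.
Qed.

Lemma mboundedM f g : mbounded D f -> mbounded D g -> mbounded D (fun x => f x * g x).
Proof.
move=> [mf [M fM]] [mg [N gN]]; split; first exact: measurable_funM.
by exists (M * N) => x Dx; rewrite normrM ler_pM ?fM ?gN.
Qed.

Lemma mboundedN f : mbounded D f -> mbounded D (fun x => - f x).
Proof.
move=> [mf [M fM]]; split; first exact: measurable_funN.
by exists M => x Dx; rewrite normrN fM.
Qed.

Lemma mboundedB f g : mbounded D f -> mbounded D g -> mbounded D (fun x => f x - g x).
Proof. by move=> mf mg; apply: mboundedD => //; exact: mboundedN. Qed.

Lemma mbounded_norm f : mbounded D f -> mbounded D (fun x => `|f x|).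
Proof.
move=> [mf [M fM]]; split; first exact: measurableT_comp.
by exists M => x Dx; rewrite normr_id fM.
Qed.

Lemma mbounded_exp f : mbounded D f -> mbounded D (fun x => expR (f x)).
Proof.
move=> [mf [M fM]]; split; first exact: measurableT_comp.
exists (expR M) => x Dx; rewrite ger0_norm ?expR_ge0// ler_expR.
by rewrite (le_trans (ler_norm _)) ?fM.
Qed.

End BoundedOn.

(** For [b <= a], the inequality [1 + (b - a) <= expR (b - a)] multiplied by [expR a] bounds the
    difference by [expR a * (a - b)]. *)
Lemma ler_dist_expR {R : realType} (t a b : R) : a <= t -> b <= t ->
  `|expR a - expR b| <= expR t * `|a - b|.
Proof.
wlog ba : a b / b <= a => [H at_ bt|at_ _].
  by have [/H->//|/ltW /H] := leP b a; rewrite distrC (distrC a); exact.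
rewrite !ger0_norm ?subr_ge0 ?ler_expR//.
rewrite (le_trans (_ : _ <= expR a * (a - b)))//; last first.
  by rewrite ler_wpM2r ?subr_ge0 ?ler_expR.
have := expR_ge1Dx (b - a); rewrite expRD expRN ler_pdivlMr ?expR_gt0//.
by rewrite mulrC; lra.
Qed.

Ltac mbounded := do ?[assumption | exact: mbounded_cst | apply: mboundedB
  | apply: mboundedD | apply: mboundedM | apply: mbounded_exp | apply: mbounded_norm].

(** * Expectations and comparison of weighted means *)

Section Expectation.
Context {disp : measure_display} {T : measurableType disp} {R : realType}.
Context {P : probability T R} {D : set T}.
Hypotheses (mD : measurable D) (PD : P (~` D) = 0%E).
Implicit Types f g h w l : T -> R.

(** The complement of [D] is negligible, and on [D] the function is bounded while the measure is
    finite. *)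
Lemma mbounded_integrable f : mbounded D f -> P.-integrable setT (EFin \o f).
Proof.
move=> [mf [M fM]].
have mDc := measurableC mD.
apply/(negligible_integrable mDc) => //.
  exact/measurable_EFinP.
rewrite setTD setCK; apply: measurable_bounded_integrable => //.
- by rewrite (le_lt_trans (probability_le1 P mD))// ltry.
- exact: measurable_funS mf.
- exists M; split; first exact: num_real.
  by move=> N MN x Dx /=; rewrite (le_trans (fM _ Dx))// ltW.
Qed.

Lemma le_Rexpect f g : mbounded D f -> mbounded D g ->
  (forall x, D x -> f x <= g x) -> \int[P]_x f x <= \int[P]_x g x.
Proof.
move=> bf bg fg; have mDc := measurableC mD.
have H h : mbounded D h -> \int[P]_x h x = \int[P]_(x in D) h x.
  move=> bh; rewrite /Rintegral (negligible_integral mDc) ?setTD ?setCK//.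
  exact: mbounded_integrable.
have J h : mbounded D h -> P.-integrable D (EFin \o h).
  by move=> bh; apply: integrableS (mbounded_integrable _ bh).
by rewrite !H//; apply: le_Rintegral => //; exact: J.
Qed.

Lemma Rexpect_cst (c : R) : \int[P]_x c = c.
Proof. by rewrite Rintegral_cst// [X in fine X]probability_setT mulr1. Qed.

Lemma RexpectD f g : mbounded D f -> mbounded D g ->
  \int[P]_x (f x + g x) = \int[P]_x f x + \int[P]_x g x.
Proof. by move=> bf bg; rewrite RintegralD//; exact: mbounded_integrable. Qed.

Lemma RexpectB f g : mbounded D f -> mbounded D g ->
  \int[P]_x (f x - g x) = \int[P]_x f x - \int[P]_x g x.
Proof. by move=> bf bg; rewrite RintegralB//; exact: mbounded_integrable. Qed.

Lemma RexpectZ (c : R) f : mbounded D f ->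
  \int[P]_x (c * f x) = c * \int[P]_x f x.
Proof. by move=> bf; rewrite RintegralZl//; exact: mbounded_integrable. Qed.

Lemma Rexpect_norm_le f g : mbounded D f -> mbounded D g ->
  (forall x, D x -> `|f x| <= g x) -> `|\int[P]_x f x| <= \int[P]_x g x.
Proof.
move=> bf bg fg; apply: le_trans (le_normr_Rintegral _ _) _ => //.
  exact: mbounded_integrable.
by apply: le_Rexpect => //; exact: mbounded_norm.
Qed.

Lemma Rexpect_ge_cst (c : R) f : mbounded D f ->
  (forall x, D x -> c <= f x) -> c <= \int[P]_x f x.
Proof.
move=> bf cf; rewrite -[leLHS]Rexpect_cst.
by apply: le_Rexpect => //; exact: mbounded_cst.
Qed.

Lemma Rexpect_sqr_le f : mbounded D f ->
  (\int[P]_x f x) ^+ 2 <= \int[P]_x (f x ^+ 2).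
Proof.
move=> bf; set m := \int[P]_x f x.
have bf2 : mbounded D (fun x => f x ^+ 2) by exact: mboundedM.
(* The variance is nonnegative. *)
have : 0 <= \int[P]_x (f x ^+ 2 - 2 * m * f x + m ^+ 2).
  apply: Rintegral_ge0 => x _.
  rewrite (_ : _ + _ = (f x - m) ^+ 2) ?sqr_ge0//; ring.
rewrite RexpectD ?RexpectB ?RexpectZ ?Rexpect_cst; try by mbounded.
by rewrite -/m; nra.
Qed.

(* A weighted mean minimises the weighted quadratic deviation, so [l - c]
   costs [s] and not [2 * s]. *)
Lemma weighted_deviation_le w l (c s : R) :
  mbounded D w -> mbounded D l -> 0 <= s ->
  (forall x, D x -> 0 <= w x) -> (forall x, D x -> `|l x| <= s) ->
  0 < \int[P]_x w x -> \int[P]_x (w x * l x) = c * \int[P]_x w x ->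
  \int[P]_x (w x * `|l x - c|) <= s * \int[P]_x w x.
Proof.
move=> bw bl s0 w0 ls; set Z := \int[P]_x w x => Z0 cZ.
have bc : mbounded D (fun=> c) by exact: mbounded_cst.
have bwl : mbounded D (fun x => w x * l x) by exact: mboundedM.
have bd : mbounded D (fun x => w x * `|l x - c|) by mbounded.
(* The slack [e] makes [r = s + e] positive, so that dividing by [r] is legitimate even when
   [s = 0]. *)
rewrite -ler_pdivrMr//; apply/ler_addgt0Pl => e e0.
rewrite ler_pdivrMr// addrC; set r := s + e.
have r0 : 0 < r by rewrite ltr_wpDl.
(* By AM-GM, [|l - c|] is at most [(r ^+ 2 + (l - c) ^+ 2) / (2 * r)]; replacing [l ^+ 2] by
   [r ^+ 2] there leaves an expression affine in [l], and [g] is [w] times it. Its integral needs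
   only the weighted mean [c] of [l]. *)
pose g x := (r + c ^+ 2 / (2 * r)) * w x - c / r * (w x * l x).
have -> : r * Z = \int[P]_x g x + c ^+ 2 / (2 * r) * Z.
  rewrite RexpectB ?RexpectZ; try by mbounded.
  by rewrite cZ -/Z; field; rewrite gt_eqF.
rewrite ler_wpDr//; first by rewrite mulr_ge0 ?divr_ge0 ?sqr_ge0 ?mulr_ge0// ltW.
apply: le_Rexpect => //.
  by mbounded.
move=> x Dx; rewrite /g mulrCA (mulrC _ (w x)) -mulrBr ler_wpM2l ?w0//.
have -> : r + c ^+ 2 / (2 * r) - c / r * l x =
    `|l x - c| + ((r - `|l x - c|) ^+ 2 + (r ^+ 2 - l x ^+ 2)) / (2 * r).
  have : `|l x - c| ^+ 2 = (l x - c) ^+ 2 by rewrite real_normK ?num_real.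
  move: `|l x - c| => a ac; rewrite sqrrB ac; field; rewrite gt_eqF//.
rewrite lerDl divr_ge0 ?mulr_ge0 ?(ltW r0)// addr_ge0 ?sqr_ge0// subr_ge0.
rewrite -[leLHS]real_normK ?num_real// ler_sqr ?nnegrE ?(ltW r0)//.
by rewrite (le_trans (ls _ Dx))// lerDl ltW.
Qed.

(** This controls [Gamma] when only its argument moves, which multiplies the weight by a factor
    [expR h]. One [expR H] comes from [|expR h - 1| <= H * expR H], the other from comparing the
    normalizers [Z] and [Z']; the deviation of [l] from its mean contributes [s]. *)
Lemma tilted_mean_le w h l (H s : R) :
  mbounded D w -> mbounded D h -> mbounded D l -> 0 <= s -> 0 <= H ->
  (forall x, D x -> 0 <= w x) -> 0 < \int[P]_x w x ->
  (forall x, D x -> `|h x| <= H) -> (forall x, D x -> `|l x| <= s) ->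
  `|\int[P]_x (w x * expR (h x) * l x) / \int[P]_x (w x * expR (h x))
    - \int[P]_x (w x * l x) / \int[P]_x w x| <= H * expR (2 * H) * s.
Proof.
move=> bw bh bl s0 H0 w0 Z0 hH ls.
set Z := \int[P]_x w x in Z0 *; set Z' := \int[P]_x (w x * expR (h x)).
set c := (X in _ - X).
have cZ : \int[P]_x (w x * l x) = c * Z by rewrite divfK// gt_eqF.
have dev := weighted_deviation_le _ _ _ _ bw bl s0 w0 ls Z0 cZ.
have bc : mbounded D (fun=> c) by exact: mbounded_cst.
have be := mbounded_exp _ bh.
have bwe := mboundedM _ _ bw be.
have ZZ' : expR (- H) * Z <= Z'.
  rewrite -RexpectZ//; apply: le_Rexpect => //.
    by mbounded.
  move=> x Dx; rewrite mulrC ler_wpM2l ?w0// ler_expR.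
  by have := hH _ Dx; rewrite ler_norml => /andP[].
have Z'0 : 0 < Z' by rewrite (lt_le_trans _ ZZ')// mulr_gt0 ?expR_gt0.
(* The [- 1] may be inserted because [w * (l - c)] has integral zero. *)
have -> : \int[P]_x (w x * expR (h x) * l x) / Z' - c =
   \int[P]_x (w x * (expR (h x) - 1) * (l x - c)) / Z'.
  apply: (mulIf (lt0r_neq0 Z'0)); rewrite mulrBl !divfK ?gt_eqF//.
  rewrite (_ : (fun x => w x * (expR (h x) - 1) * (l x - c)) = fun x =>
    (w x * expR (h x) * l x - c * (w x * expR (h x))) - (w x * l x - c * w x)).
    have bcw g : mbounded D g -> mbounded D (fun x => c * g x) by exact: mboundedM.
    have bwl := mboundedM _ _ bw bl.
    have bwel := mboundedM _ _ bwe bl.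
    rewrite !RexpectB ?RexpectZ; try by mbounded.
    by rewrite cZ -/Z subrr subr0.
  by apply/funext => x; ring.
rewrite normrM normfV (gtr0_norm Z'0) ler_pdivrMr//.
apply: (@le_trans _ _ (H * expR H * (s * Z))); last first.
  rewrite (_ : 2 * H = H + H) ?expRD; last by ring.
  rewrite (_ : _ * s * Z' = H * expR H * (s * (expR H * Z'))); last by ring.
  rewrite ler_wpM2l ?mulr_ge0 ?expR_ge0// ler_wpM2l//.
  by rewrite -ler_pdivrMl ?expR_gt0// -expRN.
have bwd : mbounded D (fun x => w x * `|l x - c|).
  by mbounded.
apply: le_trans (_ : _ <= H * expR H * \int[P]_x (w x * `|l x - c|)) _; last first.
  by rewrite ler_wpM2l// mulr_ge0 ?expR_ge0.
rewrite -RexpectZ//; apply: Rexpect_norm_le.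
- apply: mboundedM; last exact: mboundedB.
  by apply: mboundedM => //; apply: mboundedB => //; exact: mbounded_cst.
- by mbounded.
move=> x Dx; rewrite !normrM (ger0_norm (w0 _ Dx)).
rewrite [leRHS](_ : _ = w x * (H * expR H) * `|l x - c|); last by ring.
rewrite ler_wpM2r// ler_wpM2l ?w0// -expR0 (le_trans (ler_dist_expR H _ _ _ _))//.
- by rewrite (le_trans (ler_norm _)) ?hH.
- by rewrite subr0 mulrC ler_wpM2r ?expR_ge0 ?hH.
Qed.

(** This controls [Gamma] when only the measure moves. It is meant for [P] a coupling, with [w1],
    [l1] depending on the first point, [w2], [l2] on the second, and [r] their distance. The
    numerator costs one [expR t], the division by [Z1] the other. *)
Lemma coupled_mean_le w1 w2 l1 l2 r (t b L s : R) :
  mbounded D w1 -> mbounded D w2 -> mbounded D l1 -> mbounded D l2 ->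
  mbounded D r -> 0 <= L -> 0 <= b -> 0 <= s -> (forall x, D x -> 0 <= r x) ->
  (forall x, D x -> expR (- t) <= w1 x <= expR t) ->
  (forall x, D x -> expR (- t) <= w2 x) ->
  (forall x, D x -> `|l1 x - l2 x| <= L * r x) ->
  (forall x, D x -> `|l2 x| <= s) ->
  (forall x, D x -> `|w1 x - w2 x| <= expR t * (b * r x)) ->
  `|\int[P]_x (w1 x * l1 x) / \int[P]_x w1 x
    - \int[P]_x (w2 x * l2 x) / \int[P]_x w2 x|
  <= expR (2 * t) * (L + 2 * b * s) * \int[P]_x r x.
Proof.
move=> bw1 bw2 bl1 bl2 br L0 b0 s0 r0 w1t w2t l12 l2s w12.
set Z1 := \int[P]_x w1 x; set Z2 := \int[P]_x w2 x.
have Z1t : expR (- t) <= Z1.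
  by apply: Rexpect_ge_cst => // x Dx; have /andP[] := w1t _ Dx.
have Z10 : 0 < Z1 by rewrite (lt_le_trans _ Z1t) ?expR_gt0.
have Z20 : 0 < Z2.
  by apply: lt_le_trans (expR_gt0 (- t)) _; exact: Rexpect_ge_cst.
have w20 x : D x -> 0 <= w2 x.
  by move=> Dx; rewrite (le_trans _ (w2t _ Dx)) ?expR_ge0.
set c := (X in _ - X).
have cZ : \int[P]_x (w2 x * l2 x) = c * Z2 by rewrite divfK// gt_eqF.
have bc : mbounded D (fun=> c) by exact: mbounded_cst.
have bcw g : mbounded D g -> mbounded D (fun x => c * g x) by exact: mboundedM.
have bwl1 := mboundedM _ _ bw1 bl1.
have bwl2 := mboundedM _ _ bw2 bl2.
have cs : `|c| <= s.
  rewrite normrM normfV (gtr0_norm Z20) ler_pdivrMr// -RexpectZ//.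
  apply: Rexpect_norm_le => //; first by mbounded.
  by move=> x Dx; rewrite normrM ger0_norm ?w20// mulrC ler_wpM2r ?w20 ?l2s.
(* The integrand is [w1 * (l1 - c)] minus [w2 * (l2 - c)], and the latter has integral zero. Since
   [|c| <= s], the factor [l2 - c] is at most [2 * s], whence the term [2 * b * s]. *)
have -> : \int[P]_x (w1 x * l1 x) / Z1 - c =
    \int[P]_x (w1 x * (l1 x - l2 x) + (w1 x - w2 x) * (l2 x - c)) / Z1.
  apply: (mulIf (lt0r_neq0 Z10)); rewrite mulrBl !divfK ?gt_eqF//.
  rewrite (_ : (fun x => _ + _) = fun x =>
    (w1 x * l1 x - c * w1 x) - (w2 x * l2 x - c * w2 x)); last first.
    by apply/funext => x; ring.
  rewrite !RexpectB ?RexpectZ; try by mbounded.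
  by rewrite cZ -/Z2 subrr subr0.
rewrite normrM normfV (gtr0_norm Z10) ler_pdivrMr//.
have bcr g (a : R) : mbounded D g -> mbounded D (fun x => a * g x).
  by apply: mboundedM; exact: mbounded_cst.
apply: (@le_trans _ _ (\int[P]_x (expR t * (L + 2 * b * s) * r x))).
  apply: Rexpect_norm_le => //; last 2 first.
  - exact: bcr.
  - move=> x Dx; apply: le_trans (ler_normD _ _) _.
    rewrite !normrM -mulrA mulrDl mulrDr lerD//.
      have /andP[w1p w1l] := w1t _ Dx.
      rewrite ler_pM// ?l12// ger0_norm// (le_trans _ w1p) ?expR_ge0//.
    rewrite (_ : _ * _ = expR t * (b * r x) * (2 * s)); last by ring.
    rewrite ler_pM ?w12// mulr_natl mulr2n (le_trans (ler_normB _ _))// lerD// l2s//.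
  - by mbounded.
have r0' : 0 <= \int[P]_x r x by exact: Rexpect_ge_cst.
have -> : 2 * t = t + t by ring.
rewrite RexpectZ// expRD.
set E := \int[P]_x r x in r0' *; set K := L + 2 * b * s.
have K0 : 0 <= K by rewrite addr_ge0 ?mulr_ge0.
rewrite [leRHS](_ : _ = expR t * K * E * (expR t * Z1)); last by ring.
by rewrite ler_peMr ?mulr_ge0 ?expR_ge0// -ler_pdivrMl ?expR_gt0// mulr1 -expRN.
Qed.

End Expectation.

(** * Borel measurability and integration on Euclidean space *)

Section RvecMeasurability.
Context {R : realType}.

Lemma measurable_coord n (i : 'I_n) :
  measurable_fun setT (fun x : Rvec R n => (x : 'cV[R]_n) i ord0).
Proof.
apply: (measurability _ (RGenOpens.measurableE R)) => _ [_ [a [b ->] <-]].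
rewrite setTI; apply: sub_sigma_algebra.
apply: open_comp; last exact: interval_open.
by move=> x _; exact: coord_continuous.
Qed.

Lemma continuous_Rvec_measurable d k (f : 'cV[R]_d -> 'cV[R]_k) :
  continuous f -> measurable_fun setT (f : Rvec R d -> Rvec R k).
Proof.
move=> cf; apply: (@measurability _ _ (Rvec R d) (Rvec R k) _ _ (@open 'cV[R]_k) erefl).
move=> _ [B oB <-].
by rewrite setTI; apply: sub_sigma_algebra; apply: open_comp => // x _; exact: cf.
Qed.

(** The Lipschitz bound is asked only at distance at most [1], because the one available for [Gamma]
    on the whole space grows exponentially with the distance. *)
Lemma eucl_lipschitz_continuous d k (f : 'cV[R]_d -> 'cV[R]_k) (C : R) :
  (forall x y, eucl_norm (x - y) <= 1 ->
    eucl_norm (f x - f y) <= C * eucl_norm (x - y)) -> continuous f.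
Proof.
move=> fC y A /= /(nbhs_ballP (f y)) [e /= e0 eA].
pose D := Num.max C 0; have D0 : 0 <= D by rewrite le_max lexx orbT.
(* Balls of matrices are entrywise: [d] entries below [del] give a Euclidean norm of at most
   [d * del]. The [+ 1] in each denominator covers [D = 0] and [d = 0]. *)
pose del := Num.min 1 (e / (D + 1)) / (d%:R + 1).
have D1 : 0 < D + 1 by rewrite ltr_wpDl.
have d1 : 0 < d%:R + 1 :> R by rewrite ltr_wpDl.
have del0 : 0 < del by rewrite divr_gt0// lt_min ltr01 divr_gt0.
have small x : ball y del x -> eucl_norm (x - y) <= Num.min 1 (e / (D + 1)).
  move=> [_ yx]; apply: le_trans (eucl_norm_le_sum _ _) _.
  apply: (@le_trans _ _ (\sum_(i < d) del)).
    apply: ler_sum => i _; have := yx i ord0.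
    by rewrite !mxE distrC /ball /= => /ltW.
  rewrite sumr_const card_ord -mulr_natl mulrCA ger_pMr; last first.
    by rewrite lt_min ltr01 divr_gt0.
  by rewrite ler_pdivrMr// mul1r lerDl.
apply/nbhs_ballP; exists del => //= x /small.
move=> xdel; apply: eA; move: xdel.
rewrite le_min => /andP[xy1 xye]; split => // i j.
rewrite ord1 /ball /=.
have := coord_le_eucl_norm _ (f x - f y) i; rewrite !mxE distrC => /le_lt_trans; apply.
apply: le_lt_trans (fC _ _ xy1) _.
have N0 := eucl_norm_ge0 _ (x - y).
apply: (@le_lt_trans _ _ (D * (e / (D + 1)))).
  apply: (@le_trans _ _ (D * eucl_norm (x - y))); last by rewrite ler_wpM2l.
  by rewrite ler_wpM2r// le_max lexx.
by rewrite mulrCA gtr_pMr// ltr_pdivrMr// mul1r ltrDl.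
Qed.

(** Measurability is required entry by entry, so that differences of two components of a product
    space qualify without identifying the product sigma-algebra with a Borel one. *)
Lemma measurable_eucl_norm {disp} {T : measurableType disp} n (f : T -> 'cV[R]_n) :
  (forall i, measurable_fun setT (fun x => f x i ord0)) ->
  measurable_fun setT (fun x => eucl_norm (f x)).
Proof.
move=> mf; apply: (measurableT_comp (continuous_measurable_fun _)).
  exact: sqrt_continuous.
apply: measurable_sum => i; exact: measurable_funX.
Qed.

Lemma measurable_cball n (r : R) : measurable (cball R n r).
Proof.
have -> : cball R n r =
    (fun x : Rvec R n => eucl_norm (x : 'cV[R]_n)) @^-1` `]-oo, r]%classic.
  by apply/seteqP; split => x /=; rewrite in_itv.
rewrite -[X in measurable X]setTI; apply: measurable_eucl_norm => //.
exact: measurable_coord.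
Qed.

Lemma mbounded_coord n (r : R) (i : 'I_n) :
  mbounded (cball R n r) (fun x : Rvec R n => (x : 'cV[R]_n) i ord0).
Proof.
split; first exact: measurable_coord.
by exists r => x; apply: le_trans; exact: coord_le_eucl_norm.
Qed.

Lemma mbounded_sum {disp} {T : measurableType disp} {D : set T} {I : Type}
    (s : seq I) (f : I -> T -> R) :
  (forall i, mbounded D (f i)) -> mbounded D (fun x => \sum_(i <- s) f i x).
Proof.
move=> bf; elim: s => [|i s IH].
  by under eq_fun do rewrite big_nil; exact: mbounded_cst.
by under eq_fun do rewrite big_cons; exact: mboundedD.
Qed.

Lemma mbounded_dot n (r : R) (v : 'cV[R]_n) :
  mbounded (cball R n r) (fun x : Rvec R n => dot v x).
Proof.
by apply: mbounded_sum => i; apply: mboundedM; [exact: mbounded_cst|exact: mbounded_coord].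
Qed.

Lemma Rexpect_sum {disp} {T : measurableType disp} {P : probability T R}
    {D : set T} {I : Type} (s : seq I) (f : I -> T -> R) :
  measurable D -> P (~` D) = 0%E -> (forall i, mbounded D (f i)) ->
  \int[P]_x (\sum_(i <- s) f i x) = \sum_(i <- s) \int[P]_x f i x.
Proof.
move=> mD PD bf; elim: s => [|i s IH].
  by under eq_Rintegral do rewrite big_nil; rewrite big_nil Rexpect_cst.
under eq_Rintegral do rewrite big_cons.
by rewrite big_cons (RexpectD mD PD) ?IH//; exact: mbounded_sum.
Qed.

End RvecMeasurability.

(** * The attention map of a fixed measure: regularity in its argument *)

Section Attention.
Context {R : realType} {d k : nat} (A : 'M[R]_d) (V : 'M[R]_(k, d)) (rad : R).
Hypothesis rad0 : 0 <= rad.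
Let a := spec_norm A.
Let v := spec_norm V.
Let t := a * rad ^+ 2.

Let a0 : 0 <= a. Proof. exact: spec_norm_ge0. Qed.
Let v0 : 0 <= v. Proof. exact: spec_norm_ge0. Qed.
Let t0 : 0 <= t. Proof. by rewrite mulr_ge0 ?sqr_ge0. Qed.

Local Notation B := (cball R d rad).
Let mB : measurable B. Proof. exact: measurable_cball. Qed.

Lemma mbounded_bil x : mbounded B (fun y : Rvec R d => bil A x y).
Proof. by under eq_fun do rewrite bilE; exact: mbounded_dot. Qed.

Lemma mbounded_value e : mbounded B (fun y : Rvec R d => dot e (V *m y)).
Proof. by under eq_fun do rewrite dot_mulmx; exact: mbounded_dot. Qed.

Lemma mbounded_score x : mbounded B (fun y : Rvec R d => expR (bil A x y)).
Proof. exact: mbounded_exp (mbounded_bil x). Qed.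

#[local] Hint Resolve mbounded_bil mbounded_value mbounded_score : core.

Let le_norm_bil_ball x (y : Rvec R d) : B y -> `|bil A x y| <= a * eucl_norm x * rad.
Proof.
move=> By; apply: le_trans (le_norm_bil _ _ _ _) _.
by rewrite ler_wpM2l// mulr_ge0 ?eucl_norm_ge0.
Qed.

Let le_norm_value_ball e (y : Rvec R d) : B y ->
  `|dot e (V *m y)| <= v * rad * eucl_norm e.
Proof.
move=> By; apply: le_trans (le_norm_dot_mulmx _ _ _ _ _) _.
by rewrite mulrAC ler_wpM2r ?eucl_norm_ge0// ler_wpM2l.
Qed.

Lemma dot_Gamma (mu : probability (Rvec R d) R) e x : Pball R d rad mu ->
  dot e (Gamma A V mu x) =
  \int[mu]_y (expR (bil A x y) * dot e (V *m y)) / \int[mu]_y expR (bil A x y).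
Proof.
move=> muB; rewrite {1}/dot; under eq_bigr do rewrite mxE mulrA.
rewrite -mulr_suml; congr (_ / _).
under [RHS]eq_Rintegral do rewrite mulr_sumr.
have bs := mbounded_score x.
have bV i : mbounded B (fun y : Rvec R d => (V *m y) i ord0).
  under eq_fun do rewrite mxE; apply: mbounded_sum => j.
  by apply: mboundedM; [exact: mbounded_cst|exact: mbounded_coord].
rewrite (Rexpect_sum _ _ mB muB); last by move=> i; mbounded.
apply: eq_bigr => i _; under [RHS]eq_Rintegral do rewrite mulrCA.
by rewrite (RexpectZ mB muB)//; exact: mboundedM.
Qed.

Lemma dot_GammaB (mu nu : probability (Rvec R d) R) e x y :
  Pball R d rad mu -> Pball R d rad nu ->
  dot e (Gamma A V mu x - Gamma A V nu y) =
  \int[mu]_u (expR (bil A x u) * dot e (V *m u)) / \int[mu]_u expR (bil A x u)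
  - \int[nu]_u (expR (bil A y u) * dot e (V *m u)) / \int[nu]_u expR (bil A y u).
Proof.
by move=> muB nuB; rewrite dotDr dotNr; congr (_ - _); exact: dot_Gamma.
Qed.

Let normalizer_gt0 (mu : probability (Rvec R d) R) x : Pball R d rad mu ->
  0 < \int[mu]_y expR (bil A x y).
Proof.
move=> muB; apply: lt_le_trans (expR_gt0 (- (a * eucl_norm x * rad))) _.
apply: (Rexpect_ge_cst mB muB) => // y By; rewrite ler_expR.
by have := le_norm_bil_ball x _ By; rewrite ler_norml => /andP[].
Qed.

(** Moving from [y] to [x] tilts the weight by [expR (bil A (x - y) u)], whose exponent is at most
    [H] for [u] in the ball. The points [x] and [y] are arbitrary, which serves both continuity on
    the whole space and the passage through a midpoint. *)
Lemma Gamma_dist_le (mu : probability (Rvec R d) R) x y : Pball R d rad mu ->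
  eucl_norm (Gamma A V mu x - Gamma A V mu y) <=
  v * t * expR (2 * (a * eucl_norm (x - y) * rad)) * eucl_norm (x - y).
Proof.
move=> muB; set N := eucl_norm (x - y); set H := a * N * rad.
have N0 : 0 <= N by exact: eucl_norm_ge0.
have H0 : 0 <= H by rewrite !mulr_ge0.
apply: eucl_norm_le_dot; first by rewrite !mulr_ge0 ?expR_ge0.
move=> e; rewrite dot_GammaB//.
have -> : v * t * expR (2 * H) * N * eucl_norm e =
    H * expR (2 * H) * (v * rad * eucl_norm e) by rewrite /t /H; ring.
have E u : expR (bil A x u) = expR (bil A y u) * expR (bil A (x - y) u).
  by rewrite -expRD -bilDl subrKC.
under [X in X / _ - _]eq_Rintegral do rewrite E.
under [X in _ / X - _]eq_Rintegral do rewrite E.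
apply: (tilted_mean_le mB muB) => //.
- by rewrite !mulr_ge0 ?eucl_norm_ge0.
- exact: normalizer_gt0.
- by move=> u; exact: le_norm_bil_ball.
- by move=> u; exact: le_norm_value_ball.
Qed.

(** Being locally Lipschitz, the map is continuous, hence Borel. *)
Lemma measurable_Gamma (mu : probability (Rvec R d) R) : Pball R d rad mu ->
  measurable_fun setT (Gamma A V mu).
Proof.
move=> muB; apply: continuous_Rvec_measurable.
apply: (@eucl_lipschitz_continuous _ _ _ _ (v * t * expR (2 * (a * rad)))).
move=> x y xy; apply: le_trans (Gamma_dist_le _ _ _ muB) _.
rewrite ler_wpM2r ?eucl_norm_ge0// ler_wpM2l ?mulr_ge0// ler_expR ler_wpM2l//.
by rewrite ler_wpM2r// ler_piMr.
Qed.

(* Going through the midpoint halves the exponent, so that the cost is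
   [expR (2 * t)] and not [expR (4 * t)]. *)
Lemma Gamma_lipschitz (mu : probability (Rvec R d) R) x y : Pball R d rad mu ->
  B x -> B y ->
  eucl_norm (Gamma A V mu x - Gamma A V mu y) <=
  v * t * expR (2 * t) * eucl_norm (x - y).
Proof.
move=> muB Bx By; set N := eucl_norm (x - y).
have NR : N / 2 <= rad.
  have := eucl_normB _ x y; rewrite -/N; move: Bx By; rewrite /cball /=; lra.
have N0 : 0 <= N by exact: eucl_norm_ge0.
pose m : 'cV[R]_d := 2^-1 *: (x + y).
have nh (z : 'cV[R]_d) : eucl_norm (2^-1 *: z) = eucl_norm z / 2.
  by rewrite eucl_normZ ger0_norm ?invr_ge0// mulrC.
have xm : eucl_norm (x - m) = N / 2.
  by rewrite -nh; congr eucl_norm; apply/colP => i; rewrite !mxE; field.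
have my : eucl_norm (m - y) = N / 2.
  by rewrite -nh; congr eucl_norm; apply/colP => i; rewrite !mxE; field.
have -> : Gamma A V mu x - Gamma A V mu y =
    (Gamma A V mu x - Gamma A V mu m) + (Gamma A V mu m - Gamma A V mu y).
  by rewrite addrA subrK.
apply: le_trans (eucl_normD _ _ _) _.
apply: le_trans (lerD (Gamma_dist_le _ _ _ muB) (Gamma_dist_le _ _ _ muB)) _.
rewrite xm my -mulrDr -splitr ler_wpM2r// ler_wpM2l ?mulr_ge0// ler_expR ler_wpM2l//.
by rewrite /t expr2 [leRHS]mulrA ler_wpM2r// ler_wpM2l.
Qed.

End Attention.

(** * Couplings of measures carried by the ball *)

Section Coupling.
Context {R : realType} {d : nat} (rad : R).
Variables (mu nu : probability (Rvec R d) R).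
Variable pi : probability (Rvec R d * Rvec R d)%type R.
Hypotheses (muB : Pball R d rad mu) (nuB : Pball R d rad nu).
Hypothesis cpl : is_coupling mu nu pi.
Local Notation B := (cball R d rad).
Local Notation dist := (fun z : Rvec R d * Rvec R d => eucl_norm ((z.1 : 'cV[R]_d) - z.2)).

Lemma measurable_cballX : measurable (B `*` B).
Proof. by apply: measurableX; exact: measurable_cball. Qed.

(** A pair outside the product has a component outside the ball, and each marginal gives that event
    mass zero. *)
Lemma coupling_cballX : pi (~` (B `*` B)) = 0%E.
Proof.
have mB := measurable_cball d rad; have mBc := measurableC mB.
have mf : measurable (fst @^-1` (~` B) : set (Rvec R d * Rvec R d)).
  by rewrite -[X in measurable X]setTI; exact: measurable_fst.
have ms : measurable (snd @^-1` (~` B) : set (Rvec R d * Rvec R d)).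
  by rewrite -[X in measurable X]setTI; exact: measurable_snd.
apply: (@subset_measure0 _ _ _ pi _ (fst @^-1` (~` B) `|` snd @^-1` (~` B))).
- exact: measurableC measurable_cballX.
- exact: measurableU.
- move=> [x y] /= /not_andP[] ?; [by left|by right].
- apply: null_set_setU => //.
  + exact: etrans (cpl.1 _ mBc) muB.
  + exact: etrans (cpl.2 _ mBc) nuB.
Qed.

Lemma mbounded_fst (f : Rvec R d -> R) : mbounded B f -> mbounded (B `*` B) (fun z => f z.1).
Proof.
move=> [mf [M fM]]; split; first exact: measurableT_comp.
by exists M => -[x y] [/= Bx _]; exact: fM.
Qed.

Lemma mbounded_snd (f : Rvec R d -> R) : mbounded B f -> mbounded (B `*` B) (fun z => f z.2).
Proof.
move=> [mf [M fM]]; split; first exact: measurableT_comp.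
by exists M => -[x y] [/= _ By]; exact: fM.
Qed.

Lemma measurable_dist : measurable_fun setT dist.
Proof.
apply: measurable_eucl_norm => i; under eq_fun do rewrite !mxE.
by apply: measurable_funB; apply: (measurableT_comp (measurable_coord d i)).
Qed.

Lemma mbounded_dist : mbounded (B `*` B) dist.
Proof.
split; first exact: measurable_dist.
exists (rad + rad) => -[x y] [/= Bx By].
by rewrite ger0_norm ?eucl_norm_ge0// (le_trans (eucl_normB _ _ _))// lerD.
Qed.

Lemma coupling_fst (f : Rvec R d -> R) : mbounded B f ->
  \int[mu]_x f x = \int[pi]_z f z.1.
Proof.
move=> bf; congr fine.
transitivity (\int[pushforward pi fst]_x (f x)%:E)%E.
  by apply: eq_measure_integral => S mS _; exact/esym/cpl.1.
rewrite (integral_pushforward measurable_fst)//.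
  by apply/measurable_EFinP; case: bf.
exact: (mbounded_integrable measurable_cballX coupling_cballX _ (mbounded_fst _ bf)).
Qed.

Lemma coupling_snd (f : Rvec R d -> R) : mbounded B f ->
  \int[nu]_x f x = \int[pi]_z f z.2.
Proof.
move=> bf; congr fine.
transitivity (\int[pushforward pi snd]_x (f x)%:E)%E.
  by apply: eq_measure_integral => S mS _; exact/esym/cpl.2.
rewrite (integral_pushforward measurable_snd)//.
  by apply/measurable_EFinP; case: bf.
exact: (mbounded_integrable measurable_cballX coupling_cballX _ (mbounded_snd _ bf)).
Qed.

End Coupling.

(** * The attention map under a coupling: change of measure and quadratic cost *)

Section AttentionCoupling.
Context {R : realType} {d k : nat} (A : 'M[R]_d) (V : 'M[R]_(k, d)) (rad : R).
Hypothesis rad0 : 0 <= rad.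
Variables (mu nu : probability (Rvec R d) R).
Variable pi : probability (Rvec R d * Rvec R d)%type R.
Hypotheses (muB : Pball R d rad mu) (nuB : Pball R d rad nu).
Hypothesis cpl : is_coupling mu nu pi.
Local Notation B := (cball R d rad).
Local Notation dist := (fun z : Rvec R d * Rvec R d => eucl_norm ((z.1 : 'cV[R]_d) - z.2)).
Let a := spec_norm A.
Let v := spec_norm V.
Let t := a * rad ^+ 2.
Let L := v * (1 + 3 * a * rad ^+ 2) * expR (2 * a * rad ^+ 2).

Let a0 : 0 <= a. Proof. exact: spec_norm_ge0. Qed.
Let v0 : 0 <= v. Proof. exact: spec_norm_ge0. Qed.
Let t0 : 0 <= t. Proof. by rewrite mulr_ge0 ?sqr_ge0. Qed.
Let mBB := @measurable_cballX R d rad.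
Let piBB := coupling_cballX rad mu nu pi muB nuB cpl.

Lemma Gamma_coupling x : B x ->
  eucl_norm (Gamma A V mu x - Gamma A V nu x) <=
  v * (1 + 2 * t) * expR (2 * t) * \int[pi]_z dist z.
Proof.
move=> Bx; have dist0 : 0 <= \int[pi]_z dist z.
  by apply: Rintegral_ge0 => z _; exact: eucl_norm_ge0.
apply: eucl_norm_le_dot; first by rewrite !mulr_ge0 ?expR_ge0 ?addr_ge0 ?mulr_ge0.
move=> e; rewrite (dot_GammaB _ _ rad)//.
have bs : mbounded B (fun y : Rvec R d => expR (bil A x y)).
  exact: mbounded_score.
have bv : mbounded B (fun y : Rvec R d => dot e (V *m y)).
  exact: mbounded_value.
have bsv := mboundedM _ _ bs bv.
rewrite !(coupling_fst rad mu nu pi muB nuB cpl)//.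
rewrite !(coupling_snd rad mu nu pi muB nuB cpl)//.
(* The constant is put in the form [L + 2 * b * s] with [L = v * eucl_norm e], [b = a * rad] and
   [s = v * rad * eucl_norm e]; here [2 * b * s] equals [2 * t * L]. *)
have -> : v * (1 + 2 * t) * expR (2 * t) * (\int[pi]_z dist z) * eucl_norm e =
    expR (2 * t) * (v * eucl_norm e + 2 * (a * rad) * (v * rad * eucl_norm e))
    * \int[pi]_z dist z by rewrite /t; ring.
have bil_t y : B y -> `|bil A x y| <= t.
  move=> By; apply: le_trans (le_norm_bil _ _ _ _) _.
  by rewrite /t expr2 [leRHS]mulrA ler_pM ?mulr_ge0 ?eucl_norm_ge0// ler_wpM2l.
apply: (coupled_mean_le mBB piBB) => //.
- exact: (mbounded_fst _ _ bs).
- exact: (mbounded_snd _ _ bs).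
- exact: (mbounded_fst _ _ bv).
- exact: (mbounded_snd _ _ bv).
- exact: mbounded_dist.
- by rewrite mulr_ge0 ?eucl_norm_ge0.
- by rewrite mulr_ge0.
- by rewrite !mulr_ge0 ?eucl_norm_ge0.
- by move=> z _; exact: eucl_norm_ge0.
- by move=> z [Bz _]; rewrite !ler_expR -ler_norml bil_t.
- by move=> z [_ Bz]; rewrite ler_expR; have := bil_t _ Bz; rewrite ler_norml => /andP[].
- move=> z _; rewrite -dotNr -dotDr -mulmxN -mulmxDr.
  exact: le_norm_dot_mulmx.
- move=> z [_ Bz]; apply: le_trans (le_norm_dot_mulmx _ _ _ _ _) _.
  by rewrite mulrAC ler_wpM2r ?eucl_norm_ge0// ler_wpM2l.
- move=> z [Bz1 Bz2]; apply: le_trans (ler_dist_expR t _ _ _ _) _.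
  + exact: le_trans (ler_norm _) (bil_t _ Bz1).
  + exact: le_trans (ler_norm _) (bil_t _ Bz2).
  rewrite ler_wpM2l ?expR_ge0// -bilBr; apply: le_trans (le_norm_bil _ _ _ _) _.
  by rewrite ler_wpM2r ?eucl_norm_ge0// ler_wpM2l.
Qed.

Let p := v * t * expR (2 * t).
Let q := v * (1 + 2 * t) * expR (2 * t).

Let p0 : 0 <= p. Proof. by rewrite !mulr_ge0 ?expR_ge0. Qed.
Let q0 : 0 <= q. Proof. by rewrite !mulr_ge0 ?expR_ge0 ?addr_ge0 ?mulr_ge0. Qed.

Lemma Gamma_dist_coupling z : (B `*` B) z ->
  eucl_norm (Gamma A V mu z.1 - Gamma A V nu z.2) <=
  p * dist z + q * \int[pi]_z dist z.
Proof.
move=> [Bz1 Bz2].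
have -> : Gamma A V mu z.1 - Gamma A V nu z.2 =
  (Gamma A V mu z.1 - Gamma A V mu z.2) + (Gamma A V mu z.2 - Gamma A V nu z.2).
  by rewrite addrA subrK.
apply: le_trans (eucl_normD _ _ _) _; apply: lerD.
  exact: Gamma_lipschitz.
exact: Gamma_coupling.
Qed.

Lemma mbounded_Gamma_dist :
  mbounded (B `*` B) (fun z => eucl_norm (Gamma A V mu z.1 - Gamma A V nu z.2)).
Proof.
split.
  apply: measurable_eucl_norm => i; under eq_fun do rewrite mxE [X in _ + X]mxE.
  apply: measurable_funB; apply: (measurableT_comp (measurable_coord k i)).
    exact: (measurableT_comp (measurable_Gamma A V rad rad0 mu muB)).
  exact: (measurableT_comp (measurable_Gamma A V rad rad0 nu nuB)).
have [_ [M dM]] := @mbounded_dist R d rad.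
exists (p * M + q * \int[pi]_z dist z) => z Bz; rewrite ger0_norm ?eucl_norm_ge0//.
apply: le_trans (Gamma_dist_coupling _ Bz) _; rewrite lerD2r ler_wpM2l//.
exact: le_trans (ler_norm _) (dM _ Bz).
Qed.

Lemma Gamma_cost_EFin :
  (\int[pi]_z (eucl_norm (Gamma A V mu z.1 - Gamma A V nu z.2) ^+ 2)%:E)%E =
  (\int[pi]_z (eucl_norm (Gamma A V mu z.1 - Gamma A V nu z.2) ^+ 2))%:E.
Proof.
have bg := mbounded_Gamma_dist.
rewrite /Rintegral fineK//.
exact: integrable_fin_num (mbounded_integrable mBB piBB _ (mboundedM _ _ bg bg)).
Qed.

(** This is Minkowski's inequality for [p * dist + q * E], done by expanding the square:
    [E ^+ 2 <= J] bounds both the cross term and the constant term, leaving [(p + q) ^+ 2 * J]. *)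
Lemma Gamma_cost_le :
  \int[pi]_z (eucl_norm (Gamma A V mu z.1 - Gamma A V nu z.2) ^+ 2) <=
  L ^+ 2 * \int[pi]_z (dist z ^+ 2).
Proof.
set E := \int[pi]_z dist z; set J := \int[pi]_z (dist z ^+ 2).
have E0 : 0 <= E by apply: Rintegral_ge0 => z _; exact: eucl_norm_ge0.
have bd := mbounded_dist rad : mbounded (B `*` B) dist.
have EJ : E ^+ 2 <= J by exact: (Rexpect_sqr_le mBB piBB).
(* The [3] in the constant is [t] from the change of argument plus [2 * t] from the change of
   measure. *)
have LE : L = p + q.
  by rewrite /L -!(mulrA _ a) -/t /p /q; ring.
have bg := mbounded_Gamma_dist.
apply: (@le_trans _ _ (\int[pi]_z (p ^+ 2 * dist z ^+ 2 + 2 * p * q * E * dist z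
    + q ^+ 2 * E ^+ 2))).
  apply: (le_Rexpect mBB piBB); [exact: mboundedM|by mbounded|move=> z Bz].
  rewrite [leRHS](_ : _ = (p * dist z + q * E) ^+ 2); last by ring.
  rewrite ler_sqr ?nnegrE ?eucl_norm_ge0 ?Gamma_dist_coupling//.
  exact: addr_ge0 (mulr_ge0 p0 (eucl_norm_ge0 _ _)) (mulr_ge0 q0 E0).
rewrite !(RexpectD mBB piBB) ?(RexpectZ mBB piBB) ?Rexpect_cst; try by mbounded.
rewrite -/E -/J LE.
have -> : (p + q) ^+ 2 * J = p ^+ 2 * J + 2 * p * q * J + q ^+ 2 * J by ring.
rewrite lerD ?ler_wpM2l ?sqr_ge0// lerD2l -mulrA -expr2 ler_wpM2l//.
by rewrite !mulr_ge0 ?expR_ge0 ?addr_ge0 ?mulr_ge0.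
Qed.

End AttentionCoupling.

(** * Finiteness of the Wasserstein cost *)

Section Wasserstein.
Context {R : realType}.

Lemma le_sqrte (x y : \bar R) : (x <= y)%E -> (Defs.sqrte x <= Defs.sqrte y)%E.
Proof.
case: x y => [x| |] [y| |]//=; rewrite ?lee_fin ?leey ?leNye ?sqrtr_ge0//.
exact: ler_wsqrtr.
Qed.

Lemma sqrte_sqrM (L r : R) : 0 <= L ->
  Defs.sqrte (L ^+ 2 * r)%:E = (L%:E * Defs.sqrte r%:E)%E.
Proof. by move=> L0; rewrite /= sqrtrM ?sqr_ge0// sqrtr_sqr ger0_norm// EFinM. Qed.

(** It shows that couplings exist, so that the infimum in [W2] is not taken over the empty set. *)
Lemma product_coupling n (mu nu : probability (Rvec R n) R) :
  is_coupling mu nu (mu \x nu)%E.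
Proof.
split=> S mS.
  have -> : fst @^-1` S = S `*` [set: Rvec R n] by apply/seteqP; split => // -[x y] [].
  by rewrite [LHS]product_measure1E// [X in (_ * X)%E]probability_setT mule1.
have -> : snd @^-1` S = [set: Rvec R n] `*` S by apply/seteqP; split => // -[x y] [].
by rewrite [LHS]product_measure1E// [X in (X * _)%E]probability_setT mul1e.
Qed.

Lemma coupling_cost_EFin n (rad : R) (mu nu : probability (Rvec R n) R)
    (pi : probability (Rvec R n * Rvec R n)%type R) :
  Pball R n rad mu -> Pball R n rad nu -> is_coupling mu nu pi ->
  (\int[pi]_z (eucl_norm ((z.1 : 'cV[R]_n) - z.2) ^+ 2)%:E)%E =
  (\int[pi]_z (eucl_norm ((z.1 : 'cV[R]_n) - z.2) ^+ 2))%:E.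
Proof.
move=> muB nuB cpl; rewrite /Rintegral fineK//.
have bd := @mbounded_dist R n rad.
exact: integrable_fin_num (mbounded_integrable (@measurable_cballX R n rad)
  (coupling_cballX rad mu nu pi muB nuB cpl) _ (mboundedM _ _ bd bd)).
Qed.

(* Finiteness is needed: [0 * +oo = 0], so an infinite [W2 mu nu] would bound
   nothing when the Lipschitz constant is [0]. *)
Lemma W2_fin n (rad : R) (mu nu : probability (Rvec R n) R) :
  Pball R n rad mu -> Pball R n rad nu -> exists2 r : R, 0 <= r &
  ereal_inf [set (\int[pi]_z ((eucl_norm ((z.1 : 'cV[R]_n) - z.2)) ^+ 2)%:E)%E
                   | pi in [set pi | is_coupling mu nu pi]] = r%:E.
Proof.
move=> muB nuB; set I := ereal_inf _.
have I0 : (0 <= I)%E.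
  apply: le_ereal_inf_tmp => _ [pi _ <-].
  by apply: integral_ge0 => z _; rewrite lee_fin sqr_ge0.
have Iy : (I < +oo)%E.
  apply: (@le_lt_trans _ _
    (\int[(mu \x nu)%E]_z ((eucl_norm ((z.1 : 'cV[R]_n) - z.2)) ^+ 2)%:E)%E).
    by apply: ereal_inf_lbound; exists (mu \x nu)%E => //; exact: product_coupling.
  by rewrite (coupling_cost_EFin _ _ _ _ _ muB nuB) ?ltry//; exact: product_coupling.
have If : I \is a fin_num by rewrite ge0_fin_numE.
by exists (fine I); [exact: fine_ge0|rewrite fineK].
Qed.

End Wasserstein.

(** * Transport of couplings and the Lipschitz estimate *)

Section AttentionW2.
Context {R : realType} {d k : nat} (A : 'M[R]_d) (V : 'M[R]_(k, d)) (rad : R).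
Hypothesis rad0 : 0 <= rad.
Variables (mu nu : probability (Rvec R d) R).
Hypotheses (muB : Pball R d rad mu) (nuB : Pball R d rad nu).
Let L := spec_norm V * (1 + 3 * spec_norm A * rad ^+ 2)
               * expR (2 * spec_norm A * rad ^+ 2).

Lemma SA_coupling (pi : probability (Rvec R d * Rvec R d)%type R) :
  is_coupling mu nu pi ->
  exists2 pi' : probability (Rvec R k * Rvec R k)%type R,
    is_coupling (SA A V mu) (SA A V nu) pi' &
    (\int[pi']_z (eucl_norm ((z.1 : 'cV[R]_k) - z.2) ^+ 2)%:E =
     \int[pi]_z (eucl_norm (Gamma A V mu z.1 - Gamma A V nu z.2) ^+ 2)%:E)%E.
Proof.
move=> cpl.
pose phi (z : Rvec R d * Rvec R d) : Rvec R k * Rvec R k :=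
  (Gamma A V mu z.1, Gamma A V nu z.2).
have mGmu := measurable_Gamma A V rad rad0 mu muB.
have mGnu := measurable_Gamma A V rad rad0 nu nuB.
have mphi : measurable_fun setT phi.
  apply: measurable_fun_pair.
    exact: measurableT_comp mGmu measurable_fst.
  exact: measurableT_comp mGnu measurable_snd.
(* Bundled with its measurability, [phi] has a [distribution], the pushforward of [pi], which is a
   probability by construction. *)
pose X : {mfun (Rvec R d * Rvec R d)%type >-> (Rvec R k * Rvec R k)%type} :=
  HB.pack phi (isMeasurableFun.Build _ _ _ _ phi mphi).
exists (distribution pi X).
  split => S mS.
    have mS' : measurable (Gamma A V mu @^-1` S).
      by rewrite -[X in measurable X]setTI; exact: mGmu.
    exact: cpl.1 _ mS'.
  have mS' : measurable (Gamma A V nu @^-1` S).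
    by rewrite -[X in measurable X]setTI; exact: mGnu.
  exact: cpl.2 _ mS'.
rewrite ge0_integral_pushforward//.
- apply/measurable_EFinP; apply: measurable_funX; exact: measurable_dist.
- by move=> z _; rewrite lee_fin sqr_ge0.
Qed.

Lemma W2_SA_le : (W2 (SA A V mu) (SA A V nu) <= L%:E * W2 mu nu)%E.
Proof.
have L0 : 0 <= L.
  by rewrite !mulr_ge0 ?expR_ge0 ?spec_norm_ge0 ?addr_ge0 ?mulr_ge0 ?spec_norm_ge0 ?sqr_ge0.
rewrite /W2; have [r r0 rE] := W2_fin _ _ _ _ muB nuB; rewrite rE -sqrte_sqrM//.
apply: le_sqrte; apply/lee_addgt0Pr => e e0.
have L1 : 0 < L ^+ 2 + 1 by rewrite ltr_wpDl ?sqr_ge0.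
(* An optimal coupling is not assumed: [pi] is optimal up to this slack, which remains below [e]
   after multiplication by [L ^+ 2]; the [+ 1] covers [L = 0]. *)
have de : 0 < e / (L ^+ 2 + 1) by rewrite divr_gt0.
have : r%:E \is a fin_num by [].
rewrite -{1}rE => /(lb_ereal_inf_adherent de)[_ [pi cpl <-]].
rewrite rE (coupling_cost_EFin _ _ _ _ _ muB nuB cpl) -EFinD lte_fin => Jr.
have [pi' cpl' costE] := SA_coupling _ cpl.
apply: le_trans (ereal_inf_lbound _) _; first by exists pi'; [exact: cpl'|reflexivity].
rewrite costE (Gamma_cost_EFin A V rad rad0 mu nu pi muB nuB cpl) -EFinD lee_fin.
apply: le_trans (Gamma_cost_le A V rad rad0 mu nu pi muB nuB cpl) _; rewrite -/L.
apply: (@le_trans _ _ (L ^+ 2 * (r + e / (L ^+ 2 + 1)))).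
  by rewrite ler_wpM2l ?sqr_ge0 ?ltW.
by rewrite mulrDr lerD2l mulrCA ger_pMr// ler_pdivrMr// mul1r lerDl.
Qed.

End AttentionW2.

Theorem mainTheorem4 (R : realType) (d k : nat) (hk : (0 < k)%N)
    (rad : R) (hrad : 0 < rad) (Q K V : 'M[R]_(k, d)) :
  let A : 'M[R]_d := (Num.sqrt (k%:R : R))^-1 *: (K^T *m Q) in
  let L : R := spec_norm V * (1 + 3 * spec_norm A * rad ^+ 2)
               * expR (2 * spec_norm A * rad ^+ 2) in
  (forall mu nu : probability (Rvec R d) R,
      Pball R d rad mu -> Pball R d rad nu ->
      (W2 (SA A V mu) (SA A V nu) <= L%:E * W2 mu nu)%E) /\
  (LipW2 (Pball R d rad) (SA A V) <= L%:E)%E.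
Proof.
move=> A L; have rad0 := ltW hrad.
have W mu nu := W2_SA_le A V rad rad0 mu nu.
have L0 : 0 <= L.
  by rewrite !mulr_ge0 ?expR_ge0 ?spec_norm_ge0 ?addr_ge0 ?mulr_ge0 ?spec_norm_ge0 ?sqr_ge0.
split; first exact: W.
apply: ge_ereal_sup => _ [mu [nu [muB nuB _ ->]]]; rewrite lee_fin.
have := W _ _ muB nuB.
rewrite {2 4}/W2; have [r r0 ->] := W2_fin _ _ _ _ muB nuB.
rewrite -/L /=.
(* If [W2 mu nu] vanishes, the quotient is [0] by the convention on inverses, and [0 <= L] is
   enough; that distinct measures are at positive distance is never invoked. *)
have [->|s0] := eqVneq (Num.sqrt r) 0; first by rewrite invr0 mulr0.
have sp : 0 < Num.sqrt r by rewrite lt0r s0 sqrtr_ge0.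
(* Passing to [fine] is harmless: an infinite distance between the images would contradict the
   finite bound. *)
rewrite ler_pdivrMr// /W2; case: (ereal_inf _) => [x| |]//=.
Qed.
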